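(* Let $X,Y$ be Banach spaces, $T:X\to Y$ a bounded linear operator and $1\le p<2$. If $T$ is of weak Haar type $p$, then there exists a constant $c\ge0$ such that $\tau_p(T|\mathcal H(\mathbb D_1^n))\le c\,(1+\log n)$ for all $n\in\mathbb N$.
   Context: Dyadic intervals: $\Delta_k^{(j)}:=[\frac{j-1}{2^k},\frac{j}{2^k})$. Haar functions: for $k\ge1$, integer $j$, $\chi_k^{(j)}(t)=+2^{(k-1)/2}$ on $\Delta_k^{(2j-1)}$, $-2^{(k-1)/2}$ on $\Delta_k^{(2j)}$, $0$ otherwise, $t\in[0,1)$. $\mathbb D_1^n:=\{(k,j):k=1,\dots,n;\ j=1,\dots,2^{k-1}\}$. $\|f|L_q\|$ is the Bochner $L_q([0,1))$-norm of a vector-valued function. $\tau(T|\mathcal H(\mathbb D_1^n))$ is the least $c\ge0$ with $\|\sum_{(k,j)\in\mathbb D_1^n}Tx_k^{(j)}\chi_k^{(j)}|L_2\|\le c(\sum_{(k,j)\in\mathbb D_1^n}\|x_k^{(j)}\|^2)^{1/2}$ for all $x_k^{(j)}\in X$. For $1\le q\le2$, $\tau_q(T|\mathcal H(\mathbb D_1^n))$ is the least $c\ge0$ with $\|\sum_{(k,j)\in\mathbb D_1^n}Tx_k^{(j)}\chi_k^{(j)}|L_q\|\le c(\sum_{k=1}^n\|\sum_{j=1}^{2^{k-1}}x_k^{(j)}\chi_k^{(j)}|L_q\|^q)^{1/q}$ for all $x_k^{(j)}\in X$. For $1\le p<2$, $T$ is of weak Haar type $p$ if there is $c\ge0$ with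 $\tau(T|\mathcal H(\mathbb D_1^n))\le c\,n^{1/p-1/2}$ for all $n\in\mathbb N$. *)

(* Defs.v *)
From HB Require Import structures.
From mathcomp Require Import all_boot all_order all_algebra.
From mathcomp Require Import all_classical all_reals all_analysis.
Set Implicit Arguments. Unset Strict Implicit. Unset Printing Implicit Defensive.
Import Order.TTheory GRing.Theory Num.Theory.
Import numFieldNormedType.Exports.
Local Open Scope classical_set_scope.
Local Open Scope ring_scope.

Section Haar.
Variable R : realType.

Definition dyadic (k j : nat) : set R :=
  `[ (j.-1)%:R / 2 ^+ k, j%:R / 2 ^+ k [.

(* Haar function chi_k^(j), k >= 1, considered on [0,1) *)
Definition haar (k j : nat) (t : R) : R :=
  if t \in dyadic k (2 * j).-1 then powR 2 ((k.-1)%:R / 2)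
  else if t \in dyadic k (2 * j) then - powR 2 ((k.-1)%:R / 2)
  else 0.

Definition Lqnorm (V : normedModType R) (q : R) (f : R -> V) : \bar R :=
  poweR (\int[lebesgue_measure]_(t in `[0%R, 1%R[) ((powR `|f t| q)%:E))%E q^-1.

Definition haar_level (V : normedModType R) (x : nat -> nat -> V) (k : nat)
  : R -> V := fun t => \sum_(1 <= j < (2 ^ k.-1).+1) haar k j t *: x k j.

Definition haar_sum (V : normedModType R) (n : nat) (x : nat -> nat -> V)
  : R -> V := fun t => \sum_(1 <= k < n.+1) haar_level x k t.

Definition tau (X Y : normedModType R) (T : X -> Y) (n : nat) : \bar R :=
  ereal_inf [set c%:E | c in [set c : R | 0 <= c /\
    forall x : nat -> nat -> X,
      (Lqnorm 2 (haar_sum n (fun k j => T (x k j)))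
        <= c%:E * (powR (\sum_(1 <= k < n.+1) \sum_(1 <= j < (2 ^ k.-1).+1)
                           `|x k j| ^+ 2) 2^-1)%:E)%E]].

Definition tau_q (X Y : normedModType R) (T : X -> Y) (q : R) (n : nat)
  : \bar R :=
  ereal_inf [set c%:E | c in [set c : R | 0 <= c /\
    forall x : nat -> nat -> X,
      (Lqnorm q (haar_sum n (fun k j => T (x k j)))
        <= c%:E * poweR (\sum_(1 <= k < n.+1)
                            poweR (Lqnorm q (haar_level x k)) q) q^-1)%E]].

Definition weak_haar_type (X Y : normedModType R) (T : X -> Y) (p : R) : Prop :=
  exists c : R, 0 <= c /\ forall n : nat, (0 < n)%N ->
    (tau T n <= (c * powR n%:R (p^-1 - 2^-1))%:E)%E.

End Haar.

(* Main.v *)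
Require Import Defs.
From HB Require Import structures.
From mathcomp Require Import all_boot all_order all_algebra.
From mathcomp Require Import all_classical all_reals all_analysis.
From mathcomp Require Import ring lra.
Import Order.TTheory GRing.Theory Num.Theory.
Import numFieldNormedType.Exports.
Local Open Scope ring_scope.
Set Implicit Arguments.
Unset Strict Implicit.

(* A Haar polynomial is a Walsh-Paley martingale [f] with differences [d_k],
   i.e. a signed binary tree. Conditioning on the coins tossed where the
   martingale does not move, weak Haar type [p] gives the [L_2] inequality with
   constant [c m^(1/p-1/2)] as soon as every branch has at most [m] nonzero
   differences, whatever the depth.
   Let [S_k^p = sum_(l <= k) |d_l|^p]; both [S_k] and [|d_k|] are predictable.
   Cut [f] into the blocks [B_j] where [2^(j-1) < S_k <= 2^j], and each block
   into about [log n] classes [|d_k| ~ 2^(j-i)]. In a class, a branch has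
   about [2^(ip)] nonzero differences at most, so its image under [T] has
   squared [L_2] norm at most [C 4^j P(S_n > 2^(j-1))] uniformly in [i]; the
   differences below [2^j/n] are handled by the triangle inequality. Hence
   [E |T B_j|^2 <= C (1+log n)^2 4^j P(S_n > 2^(j-1))]. As [p < 2] and [B_j] is
   supported on [S_n > 2^(j-1)], summing over [j] with geometric weights, as in
   Marcinkiewicz interpolation, yields
   [E |T f|^p <= C (1+log n)^p E S_n^p]. *)

(** * Signed trees *)

Inductive tree (V : Type) := Leaf | Node of V & tree V & tree V.
Arguments Leaf {V}.

Section TreeMean.
Variables (R : realType) (V : zmodType).
Implicit Types (t : tree V) (w : seq V).

(* A tree encodes a Walsh-Paley martingale: along a branch, the left turn at a
   node [x] contributes the increment [x] and the right turn [- x]. *)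
Fixpoint mean t (F : seq V -> R) : R :=
  match t with
  | Leaf => F [::]
  | Node x l r =>
      (mean l (fun w => F (x :: w)) + mean r (fun w => F (- x :: w))) / 2
  end.

Fixpoint all_paths (P : seq V -> Prop) t : Prop :=
  match t with
  | Leaf => P [::]
  | Node x l r => all_paths (fun w => P (x :: w)) l /\
                  all_paths (fun w => P (- x :: w)) r
  end.

Lemma all_paths_imp (P Q : seq V -> Prop) t :
  (forall w, P w -> Q w) -> all_paths P t -> all_paths Q t.
Proof.
elim: t P Q => [|x l IHl r IHr] P Q PQ /=; first exact: PQ.
by move=> [Pl Pr]; split; [apply: IHl Pl|apply: IHr Pr] => w; apply: PQ.
Qed.

Lemma all_pathsT (P : seq V -> Prop) t : (forall w, P w) -> all_paths P t.
Proof. by move=> PT; elim: t P PT => [|x l IHl r IHr] P PT //=; split; auto. Qed.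

Lemma all_paths_ex (P : seq V -> Prop) t : all_paths P t -> exists w, P w.
Proof.
elim: t P => [|x l IHl r IHr] P /=; first by move=> ?; exists [::].
by move=> [/IHl[w Pw] _]; exists (x :: w).
Qed.

Lemma all_paths_bounded (F : seq V -> R) t :
  exists B, all_paths (fun w => F w <= B) t.
Proof.
elim: t F => [|x l IHl r IHr] F /=; first by exists (F [::]).
have [B HB] := IHl (fun w => F (x :: w)).
have [C HC] := IHr (fun w => F (- x :: w)).
exists (Num.max B C); split.
- by apply: all_paths_imp HB => w; rewrite le_max => ->.
- by apply: all_paths_imp HC => w; rewrite le_max => ->; rewrite orbT.
Qed.

Lemma le_mean (F G : seq V -> R) t :
  all_paths (fun w => F w <= G w) t -> mean t F <= mean t G.
Proof.
elim: t F G => [|x l IHl r IHr] F G //= [Hl Hr].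
by rewrite ler_pM2r// lerD ?IHl ?IHr.
Qed.

Lemma eq_mean (F G : seq V -> R) t :
  all_paths (fun w => F w = G w) t -> mean t F = mean t G.
Proof.
by elim: t F G => [|x l IHl r IHr] F G //= [/IHl-> /IHr->].
Qed.

Lemma meanD (F G : seq V -> R) t :
  mean t (fun w => F w + G w) = mean t F + mean t G.
Proof.
by elim: t F G => [|x l IHl r IHr] F G //=; rewrite IHl IHr; field.
Qed.

Lemma meanZ c (F : seq V -> R) t : mean t (fun w => c * F w) = c * mean t F.
Proof.
by elim: t F => [|x l IHl r IHr] F //=; rewrite IHl IHr; field.
Qed.

Lemma mean_cst c t : mean t (fun=> c) = c.
Proof. by elim: t => [|x l IHl r IHr] //=; rewrite IHl IHr; field. Qed.

Lemma mean_sum I (s : seq I) (F : I -> seq V -> R) t :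
  mean t (fun w => \sum_(i <- s) F i w) = \sum_(i <- s) mean t (F i).
Proof.
elim: s => [|i s IHs].
  rewrite big_nil -[RHS](mean_cst _ t); apply: eq_mean; apply: all_pathsT => w.
  by rewrite big_nil.
rewrite big_cons -IHs -meanD; apply: eq_mean; apply: all_pathsT => w.
by rewrite big_cons.
Qed.

Lemma mean_ge0 (F : seq V -> R) t : (forall w, 0 <= F w) -> 0 <= mean t F.
Proof.
by move=> F0; rewrite -(mean_cst 0 t); apply: le_mean; apply: all_pathsT.
Qed.

Fixpoint full n t : bool :=
  match n, t with
  | 0, Leaf => true
  | n'.+1, Node _ l r => full n' l && full n' r
  | _, _ => false
  end.

Fixpoint zero_tree n : tree V :=
  if n is n'.+1 then Node 0 (zero_tree n') (zero_tree n') else Leaf.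

Lemma full_zero_tree n : full n (zero_tree n).
Proof. by elim: n => //= n ->. Qed.

Lemma all_paths_zero_tree n (P : seq V -> Prop) :
  P (nseq n 0) -> all_paths P (zero_tree n).
Proof.
by elim: n P => //= n IHn P P0; rewrite oppr0; split; apply: IHn.
Qed.

Lemma full_size n t : full n t -> all_paths (fun w => size w = n) t.
Proof.
elim: n t => [|n IHn] [|x l r] //= /andP[fl fr].
by split; [move: (IHn _ fl)|move: (IHn _ fr)]; apply: all_paths_imp => w /= ->.
Qed.

End TreeMean.

(** * Sparse trees: reduction to full trees of small depth *)

Section Sparse.
Variables (R : realType) (X Y : normedModType R) (T : {linear X -> Y}).
Implicit Types (t : tree X) (w : seq X) (x y : X).

(* Below a zero node one may keep the better of the two children, since the
   martingale does not move there. *)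
Lemma compress_tree (K : R) m t y :
  all_paths (fun w => (count (fun x => x != 0%R) w <= m)%N) t ->
  exists2 t', full m t' &
    mean t (fun w => `|T (y + \sum_(x <- w) x)| ^+ 2 - K * \sum_(x <- w) `|x| ^+ 2) <=
    mean t' (fun w => `|T (y + \sum_(x <- w) x)| ^+ 2 - K * \sum_(x <- w) `|x| ^+ 2).
Proof.
elim: t y m => [|a l IHl r IHr] y m /=.
  (* A leaf is padded with zero increments to reach depth exactly [m]. *)
  move=> _; exists (zero_tree X m); first exact: full_zero_tree.
  rewrite -[leLHS](mean_cst _ (zero_tree X m)); apply: le_mean.
  apply: all_paths_zero_tree; rewrite !big_nil !big1_seq//.
    by move=> i /andP[_] /nseqP[->]; rewrite normr0 expr0n.
  by move=> i /andP[_] /nseqP[->].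
have step (t : tree X) c : `|c| = `|a| ->
  mean t (fun w => `|T (y + \sum_(x <- c :: w) x)| ^+ 2 - K * \sum_(x <- c :: w) `|x| ^+ 2) =
  - (K * `|a| ^+ 2) + mean t (fun w => `|T (y + c + \sum_(x <- w) x)| ^+ 2
     - K * \sum_(x <- w) `|x| ^+ 2).
  move=> ca; rewrite -[- _](mean_cst _ t) -meanD; apply: eq_mean.
  by apply: all_pathsT => w; rewrite !big_cons addrA ca; ring.
rewrite !step// ?normrN//.
have [a0|aN0] := eqVneq a 0.
  rewrite a0 oppr0 eqxx !addr0 => -[/(IHl y)[l' fl' ll'] /(IHr y)[r' fr' rr']].
  rewrite normr0 expr0n/= mulr0 oppr0 !add0r.
  set gl := mean l _ in ll' *; set gr := mean r _ in rr' *.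
  have [glr|glr] := leP gl gr.
    by exists r' => //; apply: le_trans rr'; lra.
  by exists l' => //; apply: le_trans ll'; lra.
(* A nonzero node is kept and uses one unit of the budget; [m = 0] is impossible since a branch
   passes through it. *)
rewrite oppr_eq0 aN0; case: m => [|m].
  by move=> [/all_paths_ex[]].
move=> [/(IHl (y + a))[l' fl' ll'] /(IHr (y - a))[r' fr' rr']].
exists (Node a l' r') => /=; first by rewrite fl' fr'.
by rewrite !step// ?normrN// ler_pM2r// lerD// lerD.
Qed.

(** The functional of [compress_tree] is the difference of the two sides, and compression does not
    decrease it. Being nonpositive on full trees of depth [m], it is nonpositive on [t]. *)
Lemma sparse_tree (K : R) m t :
  (forall t', full m t' -> mean t' (fun w => `|T (\sum_(x <- w) x)| ^+ 2)
       <= K * mean t' (fun w => \sum_(x <- w) `|x| ^+ 2)) ->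
  all_paths (fun w => (count (fun x => x != 0%R) w <= m)%N) t ->
  mean t (fun w => `|T (\sum_(x <- w) x)| ^+ 2)
    <= K * mean t (fun w => \sum_(x <- w) `|x| ^+ 2).
Proof.
move=> H /(@compress_tree K m t 0)[t' /H].
have E s : mean s (fun w => `|T (0 + \sum_(x <- w) x)| ^+ 2 -
      K * \sum_(x <- w) `|x| ^+ 2) =
    mean s (fun w => `|T (\sum_(x <- w) x)| ^+ 2)
    - K * mean s (fun w => \sum_(x <- w) `|x| ^+ 2).
  rewrite -mulNr -meanZ -meanD; apply: eq_mean; apply: all_pathsT => w.
  by rewrite add0r mulNr.
by rewrite !E; lra.
Qed.

End Sparse.

(** * Real inequalities *)

Section RealInequalities.
Variable R : realType.

Lemma sqr_sum_le n (c : nat -> R) :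
  (\sum_(i < n) c i) ^+ 2 <= n%:R * \sum_(i < n) c i ^+ 2.
Proof.
elim: n => [|n IHn]; first by rewrite !big_ord0 expr0n mul0r.
rewrite !big_ord_recr /=; move: IHn.
set A := \sum_(_ < n) c _; set Q := \sum_(_ < n) _ => IHn.
have [n0|n_gt0] := posnP n.
  by rewrite /A /Q n0 !big_ord0 !add0r mul1r.
rewrite -[n.+1%:R]natr1; have : 0 < n%:R :> R by rewrite ltr0n.
move: (n%:R : R) IHn => N IHn N0.
(* [N] times the wanted gap equals [(A - N c_n)^2 + (N + 1) (N Q - A^2)]. *)
have H1 : 0 <= (A - N * c n) ^+ 2 by exact: sqr_ge0.
have H2 : 0 <= (N + 1) * (N * Q - A ^+ 2).
  by rewrite mulr_ge0 ?subr_ge0 // addr_ge0 // ltW.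
rewrite -subr_ge0 -(pmulr_rge0 _ N0); lra.
Qed.

Lemma powR2_lt1 (s : R) : s < 0 -> powR 2 s < 1.
Proof.
by move=> s0; rewrite /powR pnatr_eq0 /= expR_lt1 pmulr_llt0 // ln_gt0 // ltr1n.
Qed.

(* Cauchy-Schwarz against geometric weights, which decay because [p < 2]. *)
Lemma sqr_sum_geometric (p g : R) n (b : nat -> R) : p < 2 -> 0 < g ->
  (\sum_(j < n.+1) b j) ^+ 2 * powR (g * 2 ^+ n) (p - 2) <=
  (1 - powR 2 (p - 2))^-1 * \sum_(j < n.+1) powR (g * 2 ^+ j) (p - 2) * b j ^+ 2.
Proof.
move=> p2 g0; set r := powR 2 (p - 2); set v := fun j => powR (g * 2 ^+ j) (p - 2).
have r1 : r < 1 by rewrite powR2_lt1// subr_lt0.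
have r0 : 0 < r by rewrite powR_gt0.
have K0 : 0 < 1 - r by rewrite subr_gt0.
have vS j : v j.+1 = v j * r.
  by rewrite /v /r -powRM ?mulr_ge0 ?exprn_ge0 ?(ltW g0)// exprSr mulrA.
have v0 j : 0 < v j by rewrite powR_gt0 // mulr_gt0// exprn_gt0.
rewrite ler_pdivlMl// -/(v n).
rewrite -[X in _ <= X]/(\sum_(j < n.+1) v j * b j ^+ 2).
elim: n => [|n IHn].
  rewrite !big_ord1 [_ * v _]mulrC ler_piMl//; last by lra.
  by apply: mulr_ge0; [exact: ltW|exact: sqr_ge0].
rewrite big_ord_recr [leRHS]big_ord_recr /=; move: IHn.
set A := \sum_(j < n.+1) b j; set Q := \sum_(j < n.+1) _.
move: (b n.+1) => c IHn.
rewrite !vS.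
(* This square absorbs the cross term of [(A + c)^2] and leaves the coefficients of [A^2] and [c^2]
   that the induction provides. *)
have H : 0 <= v n * ((1 - r) * A - r * c) ^+ 2.
  by rewrite mulr_ge0 ?sqr_ge0 // ltW.
have -> : (1 - r) * ((A + c) ^+ 2 * (v n * r)) =
  (1 - r) * (A ^+ 2 * v n) + v n * r * c ^+ 2 - v n * ((1 - r) * A - r * c) ^+ 2.
  by ring.
lra.
Qed.

(** Inactive last terms are dropped by induction. If the last index is active with scale [u], a sum
    [A <= u] is paid by the term [u^p]; otherwise [A^p <= A^2 u^(p-2)] because [p < 2], and the
    geometric Cauchy-Schwarz inequality applies. *)
Lemma powR_sum_le (p g : R) n (e : nat -> bool) (b : nat -> R) :
  0 < p -> p < 2 -> 0 < g ->
  (forall j, 0 <= b j) -> (forall j, ~~ e j -> b j = 0) ->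
  powR (\sum_(j < n) b j) p <= \sum_(j < n) (e j)%:R * powR (g * 2 ^+ j) p +
  (1 - powR 2 (p - 2))^-1 * \sum_(j < n) powR (g * 2 ^+ j) (p - 2) * b j ^+ 2.
Proof.
move=> p0 p2 g0 b0 eb.
have K0 : 0 < (1 - powR 2 (p - 2))^-1 by rewrite invr_gt0 subr_gt0 powR2_lt1// subr_lt0.
elim: n => [|n IHn].
  by rewrite !big_ord0 mulr0 addr0 powR0 ?gt_eqF.
have [en|/negP/negP en] := boolP (e n); last first.
  by rewrite !big_ord_recr /= (negbTE en) eb // expr0n /= !mulr0 mul0r !addr0.
set A := \sum_(j < n.+1) b j; set u := g * 2 ^+ n.
have u0 : 0 < u by rewrite mulr_gt0// exprn_gt0.
have A0 : 0 <= A by apply: sumr_ge0.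
have S0 : 0 <= \sum_(j < n) (e j)%:R * powR (g * 2 ^+ j) p.
  by apply: sumr_ge0 => j _; rewrite mulr_ge0 ?powR_ge0.
have Q0 : 0 <= (1 - powR 2 (p - 2))^-1 *
      \sum_(j < n.+1) powR (g * 2 ^+ j) (p - 2) * b j ^+ 2.
  by rewrite mulr_ge0 ?(ltW K0)// sumr_ge0// => j _; rewrite mulr_ge0 ?powR_ge0 ?sqr_ge0.
have [Au|uA] := leP A u.
  apply: (@le_trans _ _ (powR u p)).
    by rewrite ge0_ler_powR ?nnegrE// ltW.
  by rewrite big_ord_recr /= en mul1r -/u; lra.
apply: (@le_trans _ _ (A ^+ 2 * powR u (p - 2))); last first.
  apply: le_trans (sqr_sum_geometric _ _ p2 g0) _.
  rewrite lerDr; apply: sumr_ge0 => j _; by rewrite mulr_ge0 ?powR_ge0.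
have A1 : 0 < A by exact: lt_trans uA.
have -> : powR A p = A ^+ 2 * powR A (p - 2).
  rewrite -powR_mulrn// -powRD; first by congr (powR _ _); ring.
  by rewrite (gt_eqF A1) implybT.
rewrite ler_pM2l ?exprn_gt0//.
rewrite -[p - 2]opprB !powRN lef_pV2 ?posrE ?powR_gt0//.
by rewrite ge0_ler_powR ?nnegrE ?subr_ge0; try exact: ltW; rewrite ?(ltW p2).
Qed.

(** By doubling, all terms before [a m] sum to at most [a m]; hence the terms below [s] sum to at
    most twice the largest of them. *)
Lemma sum_doubling_le (a : nat -> R) s n :
  (forall j, 0 <= a j) -> (forall j, 2 * a j <= a j.+1) -> 0 <= s ->
  \sum_(j < n) (a j < s)%R%:R * a j <= 2 * s.
Proof.
move=> a0 aS s0.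
have sum_le m : \sum_(j < m) (a j < s)%R%:R * a j <= a m.
  elim: m => [|m IHm]; first by rewrite big_ord0.
  rewrite big_ord_recr /= (le_trans _ (aS m))// mulr2n mulrDl mul1r lerD//.
  by case: (_ < _); rewrite ?mul1r ?mul0r.
elim: n => [|n IHn]; first by rewrite big_ord0 mulr_ge0.
rewrite big_ord_recr /=; have [ans|_] := ltP (a n) s.
  by have := sum_le n; rewrite mul1r; lra.
by rewrite mul0r addr0.
Qed.

End RealInequalities.

(** * Predictable selections *)

Section Selection.
Variables (R : realType) (X : normedModType R) (p : R).
Hypothesis p0 : 0 < p.
Implicit Types (t : tree X) (w : seq X) (x y : X) (sel : R -> R -> bool).

Definition psum w : R := \sum_(x <- w) powR `|x| p.

(* The selector sees the running [p]-sum including the current increment [x],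
   and [`|x|]; both ignore the sign of [x], so selection is predictable. *)
Fixpoint select sel (s : R) w : seq X :=
  if w is x :: w' then
    let s' := s + powR `|x| p in (sel s' `|x|)%:R *: x :: select sel s' w'
  else [::].

Fixpoint select_tree sel (s : R) t : tree X :=
  if t is Node x l r then
    let s' := s + powR `|x| p in
    Node ((sel s' `|x|)%:R *: x) (select_tree sel s' l) (select_tree sel s' r)
  else Leaf.

Lemma psum_ge0 w : 0 <= psum w.
Proof. by apply: sumr_ge0 => x _; exact: powR_ge0. Qed.

Lemma psum_cons x w : psum (x :: w) = powR `|x| p + psum w.
Proof. by rewrite /psum big_cons. Qed.

(** Both turns at a node receive the same weight, so the selected increments again form a signed
    tree. *)
Lemma mean_select_tree sel s t (F : seq X -> R) :
  mean (select_tree sel s t) F = mean t (fun w => F (select sel s w)).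
Proof.
elim: t s F => [|x l IHl r IHr] s F //=.
by rewrite IHl IHr !normrN scalerN.
Qed.

Lemma all_paths_select_tree sel s t (P : seq X -> Prop) :
  all_paths (fun w => P (select sel s w)) t -> all_paths P (select_tree sel s t).
Proof.
elim: t s P => [|x l IHl r IHr] s P //= [].
rewrite normrN scalerN => Hl Hr.
by split; [apply: (IHl _ (fun w => P (_ :: w)))|apply: (IHr _ (fun w => P (_ :: w)))].
Qed.

Lemma size_select sel s w : size (select sel s w) = size w.
Proof. by elim: w s => //= x w IHw s; rewrite IHw. Qed.

Lemma select_low sel lo s w : (forall s r, sel s r -> lo < s) ->
  s + psum w <= lo -> {in select sel s w, forall x, x = 0}.
Proof.
move=> sel_lo; elim: w s => [|y w IHw] s //= ; rewrite psum_cons addrA => slo x.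
rewrite inE => /predU1P[->|]; last exact: IHw.
have [/sel_lo|_] := boolP (sel _ _); last by rewrite scale0r.
by rewrite ltNge (le_trans _ slo)// lerDl psum_ge0.
Qed.

Lemma select_norm_le sel b s w : 0 <= b -> (forall s r, sel s r -> r <= b) ->
  {in select sel s w, forall x, `|x| <= b}.
Proof.
move=> b0 sel_b; elim: w s => [|y w IHw] s x //=.
rewrite inE => /predU1P[->|]; last exact: IHw.
have [/sel_b|_] := boolP (sel _ _); first by rewrite scale1r.
by rewrite scale0r normr0.
Qed.

(** Each selected increment adds at least [a^p] to the running sum, which must still be at most
    [hi]. The maximum with 0 covers the case where [hi] is already passed and nothing more is
    selected. *)
Lemma count_select_le sel hi a s w : 0 <= a ->
  (forall s r, sel s r -> s <= hi /\ a <= r) ->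
  (count (fun x => x != 0%R) (select sel s w))%:R * powR a p
    <= Num.max 0 (hi - s).
Proof.
move=> a0 sel_hi; elim: w s => [|x w IHw] s /=; first by rewrite mul0r le_max lexx.
have := IHw (s + powR `|x| p); set N := count _ _ => {}IHw.
have xp0 : 0 <= powR `|x| p by exact: powR_ge0.
have [/sel_hi[shi ax]|_] := boolP (sel _ _); last first.
  rewrite scale0r eqxx add0n (le_trans IHw)// ge_max le_max lexx /=.
  by rewrite le_max; apply/orP; right; lra.
have axp : powR a p <= powR `|x| p by rewrite ge0_ler_powR ?nnegrE ?(ltW p0).
rewrite natrD mulrDl le_max; apply/orP; right.
have : N%:R * a `^ p <= hi - (s + `|x| `^ p).
  by apply: le_trans IHw _; rewrite ge_max lexx andbT subr_ge0.
have : (1%:R *: x != 0)%:R * a `^ p <= a `^ p.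
  by case: (_ != _); rewrite ?mul1r ?mul0r ?powR_ge0.
lra.
Qed.

Lemma sumsq_le_count (b : R) w : {in w, forall x, `|x| <= b} ->
  \sum_(x <- w) `|x| ^+ 2 <= (count (fun x => x != 0%R) w)%:R * b ^+ 2.
Proof.
elim: w => [|x w IHw] xb; first by rewrite big_nil mul0r.
rewrite big_cons /= natrD mulrDl lerD//; last first.
  by apply: IHw => y yw; apply: xb; rewrite inE yw orbT.
have [->|_] := eqVneq x 0; first by rewrite normr0 expr0n mul0r.
have := xb x (mem_head _ _) => xb'.
by rewrite mul1r lerXn2r ?nnegrE// (le_trans _ xb').
Qed.

(** A partition of unity by selectors recovers the whole branch. It is required only at reachable
    pairs, where [r^p <= s <= hi]. *)
Lemma sum_select (I : finType) (sel : I -> R -> R -> bool) s w (hi : R) : 0 <= s ->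
  (forall s r, 0 <= r -> powR r p <= s -> s <= hi ->
     \sum_i (sel i s r)%:R = 1 :> R) ->
  s + psum w <= hi ->
  \sum_i \sum_(x <- select (sel i) s w) x = \sum_(x <- w) x.
Proof.
move=> s0 sel1; elim: w s s0 => [|x w IHw] s s0 /=.
  by move=> _; rewrite big_nil big1// => i _; rewrite big_nil.
rewrite psum_cons addrA => shi.
under eq_bigr do rewrite big_cons.
have xp0 : 0 <= powR `|x| p by exact: powR_ge0.
rewrite big_split /= -scaler_suml sel1//; last 2 first.
- by rewrite lerDr.
- by apply: le_trans shi; rewrite lerDl psum_ge0.
by rewrite scale1r IHw ?big_cons// addr_ge0.
Qed.

End Selection.

(** * Blocks of comparable partial sums *)

Section Blocks.
Variables (R : realType) (X Y : normedModType R) (T : {linear X -> Y}).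
Variables (p M C : R).
Hypotheses (p1 : 1 <= p) (M0 : 0 <= M) (C0 : 0 <= C).
Hypothesis TM : forall x, `|T x| <= M * `|x|.
Hypothesis TC : forall m (t : tree X), (0 < m)%N -> full m t ->
  mean t (fun w => `|T (\sum_(x <- w) x)| ^+ 2) <=
  (C * powR m%:R (p^-1 - 2^-1)) ^+ 2 * mean t (fun w => \sum_(x <- w) `|x| ^+ 2).
Implicit Types (t : tree X) (w : seq X).

Let p_gt0 : 0 < p. Proof. exact: lt_le_trans ltr01 p1. Qed.

Definition window (lo hi a b s r : R) := (lo < s <= hi) && (a < r <= b).

(** With at most [m] nonzero increments of norm at most [b], the type inequality gives
    [C^2 m^(2/p-1) m b^2 = C^2 m^(2/p) b^2]. As [m^(1/p) <= 2^(i+1)] and [b = theta / 2^i], the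
    dependence on [i] cancels. *)
Lemma window_bound t theta lo i : 0 < theta ->
  mean t (fun w => `|T (\sum_(x <- select p
     (window lo (powR theta p) (theta / 2 ^+ i.+1) (theta / 2 ^+ i)) 0 w) x)| ^+ 2)
  <= (2 * C * theta) ^+ 2 * mean t (fun w => (lo < psum p w)%R%:R).
Proof.
move=> th0; set b := theta / 2 ^+ i; set a := theta / _; set sel := window _ _ _ _.
have a0 : 0 < a by rewrite divr_gt0// exprn_gt0.
have b0 : 0 < b by rewrite divr_gt0// exprn_gt0.
(* The [p]-th powers of the selected norms sum to at most [theta^p] and each is at least [a^p], so
   the count is at most [(theta / a)^p]; being an integer, it survives truncation. *)
set m := Num.truncn (powR (2 ^+ i.+1 : R) p).
have m0 : (0 < m)%N.
  rewrite truncn_gt0 -[leLHS](powRr0 (2 ^+ i.+1)) ler_powR ?(ltW p_gt0)//.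
  by rewrite exprn_ege1// ler1n.
have cnt w : (count (fun x => x != 0%R) (select p sel 0 w) <= m)%N.
  rewrite truncn_ge_nat ?powR_ge0//.
  have : (count (fun x => x != 0%R) (select p sel 0 w))%:R * powR a p <= powR theta p.
    have selP s r : sel s r -> s <= powR theta p /\ a <= r.
      by move=> /andP[/andP[_ ->] /andP[/ltW-> _]].
    apply: le_trans (count_select_le p_gt0 0 w (ltW a0) selP) _.
    by rewrite subr0 ge_max powR_ge0 lexx.
  have -> : powR theta p = powR (2 ^+ i.+1 : R) p * powR a p.
    by rewrite -powRM ?exprn_ge0 ?(ltW a0)// /a mulrCA divff ?mulr1// expf_neq0.
  by rewrite ler_pM2r// powR_gt0.
rewrite -(mean_select_tree p sel 0 t (fun w => `|T (\sum_(x <- w) x)| ^+ 2)).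
apply: le_trans (sparse_tree (fun u => @TC m u m0) _) _.
  by apply: all_paths_select_tree; apply: all_pathsT.
rewrite mean_select_tree.
apply: (@le_trans _ _ ((C * powR m%:R (p^-1 - 2^-1)) ^+ 2 *
    (m%:R * b ^+ 2 * mean t (fun w => (lo < psum p w)%R%:R)))).
  rewrite ler_wpM2l ?sqr_ge0// -meanZ; apply: le_mean; apply: all_pathsT => w.
  have [_|slo] := ltP lo (psum p w).
    rewrite mulr1; apply: le_trans (sumsq_le_count (b := b) _) _.
      apply: select_norm_le (ltW b0) _ => s r.
      by move=> /andP[_ /andP[_ ->]].
    by rewrite ler_wpM2r ?sqr_ge0// ler_nat.
  rewrite mulr0 big1_seq// => x /andP[_ xs].
  rewrite (select_low (sel := sel) (lo := lo) _ _ xs) ?normr0 ?expr0n ?add0r//.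
  by move=> s r /andP[/andP[]].
rewrite mulrA ler_wpM2r ?mean_ge0//.
have mR : 0 < m%:R :> R by rewrite ltr0n.
have mE : powR m%:R (p^-1 - 2^-1) ^+ 2 * m%:R = powR m%:R (p^-1) ^+ 2 :> R.
  have -> : powR m%:R p^-1 = powR m%:R (p^-1 - 2^-1) * powR m%:R 2^-1 :> R.
    rewrite -powRD; first by congr (powR _ _); ring.
    by rewrite (gt_eqF mR) implybT.
  rewrite exprMn; congr (_ * _).
  by rewrite powR12_sqrt ?sqr_sqrtr// ltW.
have mle : powR m%:R (p^-1) <= 2 ^+ i.+1 :> R.
  have -> : 2 ^+ i.+1 = powR (powR (2 ^+ i.+1 : R) p) p^-1.
    by rewrite -powRrM divff ?powRr1 ?exprn_ge0// gt_eqF.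
  rewrite ge0_ler_powR ?nnegrE ?invr_ge0 ?(ltW p_gt0) ?powR_ge0 ?(ltW mR)//.
  by rewrite -truncn_ge_nat ?powR_ge0.
have -> : (C * powR m%:R (p^-1 - 2^-1)) ^+ 2 * (m%:R * b ^+ 2) =
    powR m%:R p^-1 ^+ 2 * (C * b) ^+ 2 by rewrite -mE; ring.
have -> : (2 * C * theta) ^+ 2 = (2 ^+ i.+1) ^+ 2 * (C * b) ^+ 2.
  by rewrite -exprMn; congr (_ ^+ 2); rewrite /b exprS; field; rewrite expf_neq0.
by rewrite ler_wpM2r ?sqr_ge0// lerXn2r ?nnegrE ?powR_ge0 ?exprn_ge0.
Qed.

(** Here boundedness of [T] suffices: [n] increments of norm at most [b] sum to norm at most
    [theta]. The lower end [-1] admits every small norm, zero included. *)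
Lemma small_window_bound t theta lo hi b n : 0 <= b -> n%:R * b <= theta ->
  all_paths (fun w => (size w <= n)%N) t ->
  mean t (fun w => `|T (\sum_(x <- select p (window lo hi (-1) b) 0 w) x)| ^+ 2)
  <= (M * theta) ^+ 2 * mean t (fun w => (lo < psum p w)%R%:R).
Proof.
move=> b0 nb tn; rewrite -meanZ; apply: le_mean; apply: all_paths_imp tn => w wn.
set sel := window _ _ _ _.
have [_|slo] := ltP lo (psum p w); last first.
  rewrite mulr0 big1_seq ?linear0 ?normr0 ?expr0n// => x /andP[_ xs].
  rewrite (select_low (sel := sel) (lo := lo) _ _ xs) ?add0r//.
  by move=> s r /andP[/andP[]].
have th0 : 0 <= theta by apply: le_trans nb; rewrite mulr_ge0.
rewrite mulr1 lerXn2r ?nnegrE ?mulr_ge0// (le_trans (TM _))// ler_wpM2l//.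
apply: le_trans nb.
apply: (@le_trans _ _ ((size w)%:R * b)); last by rewrite ler_wpM2r// ler_nat.
rewrite -(size_select p sel 0 w).
have : {in select p sel 0 w, forall x, `|x| <= b}.
  by apply: select_norm_le => // s r /andP[_ /andP[_ ->]].
elim: (select _ _ _ _) => [|x u IHu] ub; first by rewrite big_nil normr0 mul0r.
rewrite big_cons -natr1 mulrDl mul1r addrC (le_trans (ler_normD _ _))//.
rewrite lerD ?ub ?mem_head//; apply: IHu => y yu.
by apply: ub; rewrite inE yu orbT.
Qed.

(* The [i]-th of the dyadic classes of increments at scale [theta]; the last
   one, [i = L], gathers all the increments of norm at most [theta / 2 ^ L]. *)
Definition block_window (L : nat) (lo theta : R) (i : nat) :=
  window lo (powR theta p) (if (i < L)%N then theta / 2 ^+ i.+1 else -1)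
    (theta / 2 ^+ i).

Definition block_norm (L : nat) (lo theta : R) w : R :=
  \sum_(i < L.+1) `|T (\sum_(x <- select p (block_window L lo theta i) 0 w) x)|.

Lemma block_norm_ge0 L lo theta w : 0 <= block_norm L lo theta w.
Proof. exact: sumr_ge0. Qed.

Lemma block_norm_eq0 L lo theta w :
  psum p w <= lo -> block_norm L lo theta w = 0.
Proof.
move=> slo; rewrite /block_norm big1// => i _.
rewrite big1_seq ?linear0 ?normr0// => x /andP[_ xs].
rewrite (select_low _ _ xs (lo := lo)) ?add0r//.
by move=> s r /andP[/andP[]].
Qed.

(** Cauchy-Schwarz over the classes costs one factor [L.+1], adding their uniform bounds another.
    The condition [n <= 2 ^ L] makes the last class small enough for the triangle inequality. The
    added [1] keeps the constant positive. *)
Lemma block_bound t L n lo theta : (n <= 2 ^ L)%N -> 0 < theta ->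
  all_paths (fun w => (size w <= n)%N) t ->
  mean t (fun w => block_norm L lo theta w ^+ 2) <=
  (L.+1%:R * (2 * C + M + 1) * theta) ^+ 2 *
    mean t (fun w => (lo < psum p w)%R%:R).
Proof.
move=> nL th0 tn; set P := mean t (fun w => (_ < _)%R%:R).
have P0 : 0 <= P by apply: mean_ge0.
apply: (@le_trans _ _ (L.+1%:R * \sum_(i < L.+1) mean t (fun w =>
    `|T (\sum_(x <- select p (block_window L lo theta i) 0 w) x)| ^+ 2))).
  rewrite -mean_sum -meanZ; apply: le_mean; apply: all_pathsT => w.
  exact: (sqr_sum_le _ (fun i =>
    `|T (\sum_(x <- select p (block_window L lo theta i) 0 w) x)|)).
apply: (@le_trans _ _ (L.+1%:R * \sum_(i < L.+1) (((2 * C + M + 1) * theta) ^+ 2 * P))).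
  rewrite ler_wpM2l//; apply: ler_sum => i _; rewrite /block_window.
  have [iL|Li] := ltnP i L.
    apply: le_trans (window_bound _ _ _ th0) _; rewrite ler_wpM2r//.
    rewrite lerXn2r ?nnegrE ?mulr_ge0 ?addr_ge0 ?mulr_ge0 ?(ltW th0)//.
    by rewrite ler_pM2r//; move: C0 M0; lra.
  apply: le_trans (small_window_bound (theta := theta) (n := n) _ _ _ _ _) _ => //.
  - by rewrite divr_ge0 ?exprn_ge0 // ltW.
  - rewrite mulrCA ler_piMr ?(ltW th0)// ler_pdivrMr ?exprn_gt0// mul1r.
    rewrite -natrX ler_nat (leq_trans nL)// leq_exp2l//.
  rewrite ler_wpM2r// lerXn2r ?nnegrE ?mulr_ge0 ?addr_ge0 ?mulr_ge0 ?(ltW th0)//.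
  by rewrite ler_pM2r//; move: C0 M0; lra.
rewrite sumr_const card_ord -mulr_natl.
by rewrite -subr_ge0 [leRHS](_ : _ = 0)//; ring.
Qed.

End Blocks.

(** * Summation over the blocks: the [L_p] inequality for trees *)

Section TreeType.
Variables (R : realType) (X Y : normedModType R) (T : {linear X -> Y}).
Variables (p M C : R).
Hypotheses (p1 : 1 <= p) (p2 : p < 2) (M0 : 0 <= M) (C0 : 0 <= C).
Hypothesis TM : forall x, `|T x| <= M * `|x|.
Hypothesis TC : forall m (t : tree X), (0 < m)%N -> full m t ->
  mean t (fun w => `|T (\sum_(x <- w) x)| ^+ 2) <=
  (C * powR m%:R (p^-1 - 2^-1)) ^+ 2 * mean t (fun w => \sum_(x <- w) `|x| ^+ 2).
Implicit Types (t : tree X) (w : seq X).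

Let p_gt0 : 0 < p. Proof. exact: lt_le_trans ltr01 p1. Qed.

(** Block [j] lies between [level j] and [level j.+1]. Starting at [-1] rather than 0 lets block 0
    contain the running sum 0. *)
Definition level (th0 : R) (j : nat) : R :=
  if j is j'.+1 then powR (th0 * 2 ^+ j') p else -1.

Lemma sum_window_level th0 J s : 0 <= s -> s <= level th0 J ->
  0 <= th0 ->
  \sum_(j < J) (level th0 j < s <= level th0 j.+1)%R%:R = 1 :> R.
Proof.
move=> s0 + th0_ge0.
have inc j : level th0 j <= level th0 j.+1.
  case: j => [|j] /=; first by rewrite (le_trans _ (powR_ge0 _ _))// lerN10.
  rewrite ge0_ler_powR ?nnegrE ?(ltW p_gt0) ?mulr_ge0 ?exprn_ge0//.
  by rewrite ler_wpM2l// ler_weXn2l// ler1n.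
suff -> : \sum_(j < J) (level th0 j < s <= level th0 j.+1)%R%:R
    = (s <= level th0 J)%R%:R :> R by move=> ->.
elim: J => [|J IHJ].
  by rewrite big_ord0 /= leNgt (lt_le_trans _ s0)// ltrN10.
rewrite big_ord_recr IHJ; have [sJ|Js] := leP s (level th0 J).
  by rewrite (le_trans sJ (inc _)) /= addr0.
by rewrite /= add0r.
Qed.

(** The size intervals of the first [L] classes telescope, and the last class catches what lies
    below them. *)
Lemma sum_block_window L lo theta s r : 0 <= theta -> 0 <= r -> r <= theta ->
  \sum_(i < L.+1) (block_window p L lo theta i s r)%:R
  = (lo < s <= powR theta p)%R%:R :> R.
Proof.
move=> th0 r0 rth; rewrite /block_window /window.
case: (lo < s <= _) => /=; last by rewrite big1.
have dec i : theta / 2 ^+ i.+1 <= theta / 2 ^+ i.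
  by rewrite ler_wpM2l// lef_pV2 ?posrE ?exprn_gt0// ler_weXn2l// ler1n.
have sum_lt m : \sum_(i < m) (theta / 2 ^+ i.+1 < r <= theta / 2 ^+ i)%R%:R
    = (theta / 2 ^+ m < r)%R%:R :> R.
  elim: m => [|m IHm]; first by rewrite big_ord0 expr0 divr1 ltNge rth.
  rewrite big_ord_recr IHm /=; have [mr|rm] := ltP (theta / 2 ^+ m) r.
    by rewrite (le_lt_trans (dec m) mr) andbF addr0.
  by rewrite andbT add0r.
rewrite big_ord_recr /= ltnn (lt_le_trans _ r0) ?ltrN10//=.
under eq_bigr do rewrite ltn_ord.
by rewrite sum_lt; case: ltP; rewrite ?addr0 ?add0r.
Qed.

Lemma norm_le_sum_blocks L th0 J w : 0 <= th0 -> psum p w <= level th0 J ->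
  `|T (\sum_(x <- w) x)| <=
  \sum_(j < J) block_norm T p L (level th0 j) (th0 * 2 ^+ j) w.
Proof.
move=> th0_ge0 wJ.
pose sel (ji : 'I_J * 'I_L.+1) :=
  block_window p L (level th0 ji.1) (th0 * 2 ^+ ji.1) ji.2.
rewrite -(sum_select (p := p) (sel := sel) (s := 0) (hi := level th0 J))//.
- rewrite linear_sum (le_trans (ler_norm_sum _ _ _))//.
  by rewrite /block_norm pair_bigA.
- move=> s r r0 rs sJ; rewrite -(pair_bigA _ (fun j i => (sel (j, i) s r)%:R)) /=.
  have s0 : 0 <= s by rewrite (le_trans _ rs)// powR_ge0.
  rewrite -[RHS](sum_window_level s0 sJ th0_ge0); apply: eq_bigr => j _.
  have thj : 0 <= th0 * 2 ^+ j by rewrite mulr_ge0// exprn_ge0.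
  have [rth|thr] := leP r (th0 * 2 ^+ j).
    by rewrite /sel /= sum_block_window.
  (* For an increment longer than the scale of block [j], both sides vanish: no class admits its
     norm, and [r^p <= s] puts [s] above the top level. *)
  rewrite big1 => [|i _].
    suff -> : (s <= level th0 j.+1) = false by rewrite andbF.
    apply/negbTE; rewrite -ltNge; apply: lt_le_trans rs.
    by rewrite gt0_ltr_powR ?nnegrE.
  suff -> : sel (j, i) s r = false by [].
  apply/negbTE; rewrite !negb_and -!ltNge; apply/orP; right; apply/orP; right.
  apply: le_lt_trans thr => /=.
  by rewrite ler_piMr// invf_le1 ?exprn_gt0// exprn_ege1// ler1n.
- by rewrite add0r.
Qed.

Lemma tree_type t n L : (n <= 2 ^ L)%N ->
  all_paths (fun w => (size w <= n)%N) t ->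
  mean t (fun w => powR `|T (\sum_(x <- w) x)| p) <=
  8 * (1 + (1 - powR 2 (p - 2))^-1) *
    powR (L.+1%:R * (2 * C + M + 1)) p * mean t (psum p).
Proof.
move=> nL tn; set K := (1 - _)^-1; set D := L.+1%:R * _.
have K0 : 0 < K by rewrite invr_gt0 subr_gt0 powR2_lt1// subr_lt0.
have D0 : 0 < D.
  by rewrite mulr_gt0// ltr_wpDl// addr_ge0// mulr_ge0.
(* Here [e] is the [p]-th power of the lowest scale [th0]. It pays for block 0, up to the common
   factor, and may be taken arbitrarily small. *)
suff H e : 0 < e -> mean t (fun w => powR `|T (\sum_(x <- w) x)| p) <=
    (1 + K) * powR D p * (e + 8 * mean t (psum p)).
  apply/ler_addgt0Pr => e e0.
  have B0 : 0 < (1 + K) * powR D p by rewrite mulr_gt0 ?powR_gt0// addr_gt0.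
  apply: le_trans (H _ (divr_gt0 e0 B0)) _.
  rewrite mulrDr [_ * (e / _)]mulrCA divff ?gt_eqF// mulr1 addrC.
  by rewrite lerD2r -subr_ge0 [leRHS](_ : _ = 0)//; ring.
move=> e0; pose th0 := powR e p^-1.
have th0_gt0 : 0 < th0 by rewrite powR_gt0.
have th0p : powR th0 p = e.
  by rewrite -powRrM mulVf ?gt_eqF// powRr1// ltW.
(* A finite tree has bounded [p]-sums, so finitely many blocks cover all branches. *)
have [J wJ] : exists J, all_paths (fun w => psum p w <= level th0 J.+1) t.
  have [B tB] := all_paths_bounded (psum p) t.
  exists (Num.truncn (B / e)).+1; apply: all_paths_imp tB => w /le_trans; apply.
  rewrite /= powRM ?exprn_ge0 ?(ltW th0_gt0)// th0p mulrC -ler_pdivrMr//.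
  apply: (@le_trans _ _ (Num.truncn (B / e)).+1%:R).
    exact: ltW (truncnS_gt _).
  apply: (@le_trans _ _ (2 ^+ (Num.truncn (B / e)).+1)).
    by rewrite -natrX ler_nat ltnW// ltn_expl.
  by rewrite le1r_powR// exprn_ege1// ler1n.
set N := J.+1 in wJ.
pose b j := block_norm T p L (level th0 j) (th0 * 2 ^+ j).
pose E j w := (level th0 j < psum p w)%R.
(* Scales are dilated by the constant [D] of [block_bound]: with [u = D th0 2^j], the quadratic
   terms have mean at most [u^(p-2) u^2 P(E j)], matching the other terms. *)
have g0 : 0 < D * th0 by rewrite mulr_gt0.
apply: (@le_trans _ _ (mean t (fun w =>
    \sum_(j < N) (E j w)%:R * powR (D * th0 * 2 ^+ j) p +
    K * \sum_(j < N) powR (D * th0 * 2 ^+ j) (p - 2) * b j w ^+ 2))).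
  apply: le_mean; apply: all_paths_imp wJ => w wJ.
  apply: (@le_trans _ _ (powR (\sum_(j < N) b j w) p)).
    rewrite ge0_ler_powR ?nnegrE ?(ltW p_gt0) ?sumr_ge0//.
      by move=> j _; exact: block_norm_ge0.
    by apply: norm_le_sum_blocks => //; exact: ltW.
  apply: (@powR_sum_le R p (D * th0) N (E ^~ w) (b ^~ w)) => //.
    by move=> j; exact: block_norm_ge0.
  by move=> j; rewrite /E -leNgt; exact: block_norm_eq0.
rewrite meanD meanZ mean_sum.
have th_gt0 j : 0 < th0 * 2 ^+ j by rewrite mulr_gt0// exprn_gt0.
have Eb (j : nat) : mean t (fun w => powR (D * th0 * 2 ^+ j) (p - 2) * b j w ^+ 2)
    <= mean t (fun w => (E j w)%:R * powR (D * th0 * 2 ^+ j) p).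
  rewrite meanZ.
  apply: (@le_trans _ _ (powR (D * th0 * 2 ^+ j) (p - 2) *
      ((D * th0 * 2 ^+ j) ^+ 2 * mean t (fun w => (E j w)%:R)))).
    rewrite ler_wpM2l ?powR_ge0// -[D * th0 * _]mulrA.
    exact: (block_bound p1 M0 C0 TM TC (level th0 j) nL (th_gt0 j) tn).
  have u0 : 0 < D * th0 * 2 ^+ j by rewrite -mulrA mulr_gt0.
  rewrite mulrA -[(_ * _) ^+ 2]powR_mulrn ?(ltW u0)// -powRD; last first.
    by rewrite (gt_eqF u0) implybT.
  rewrite subrK -meanZ; apply: le_mean; apply: all_pathsT => w.
  by rewrite mulrC.
apply: (@le_trans _ _ ((1 + K) * \sum_(j < N) mean t
    (fun w => (E j w)%:R * powR (D * th0 * 2 ^+ j) p))).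
  rewrite mulrDl mul1r lerD2l ler_wpM2l ?(ltW K0)// mean_sum.
  by apply: ler_sum => j _; exact: Eb.
rewrite -mulrA ler_wpM2l ?addr_ge0 ?(ltW K0)//.
rewrite -mean_sum -(mean_cst e t) -meanZ -meanD -meanZ.
apply: le_mean; apply: all_pathsT => w.
have -> : \sum_(j < N) (E j w)%:R * powR (D * th0 * 2 ^+ j) p =
    powR D p * \sum_(j < N) (E j w)%:R * powR (th0 * 2 ^+ j) p.
  rewrite mulr_sumr; apply: eq_bigr => j _.
  by rewrite -mulrA powRM ?(ltW D0) ?(ltW (th_gt0 _))// mulrCA.
rewrite ler_wpM2l ?powR_ge0//.
(* Block 0 costs at most [e]. For the others, [E j.+1] says that [(th0 2^j)^p] is below the [p]-sum;
   the doubling lemma gives a factor 2 and the index shift a factor [2^p <= 4], whence 8. *)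
rewrite /N big_ord_recl; apply: lerD.
  by rewrite expr0 mulr1 th0p; case: (E _ _); rewrite ?mul1r ?mul0r ?(ltW e0).
have doub j : powR (th0 * 2 ^+ j.+1) p = powR 2 p * powR (th0 * 2 ^+ j) p.
  by rewrite -powRM ?(ltW (th_gt0 _))// exprS mulrCA.
have two_le : 2 <= powR 2 p :> R by rewrite le1r_powR// ler1n.
have le_four : powR 2 p <= 4 :> R.
  have -> : 4 = powR 2 2%:R :> R by rewrite powR_mulrn// -natrX.
  by rewrite ler_powR ?ler1n// ltW.
under eq_bigr do rewrite /= /bump /= add1n doub mulrCA.
rewrite -mulr_sumr.
have := @sum_doubling_le R (fun j => powR (th0 * 2 ^+ j) p) (psum p w) J.
rewrite -[\sum_(i < J) _]/(\sum_(i < J) (E i.+1 w)%:R * powR (th0 * 2 ^+ i) p).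
move=> /(_ (fun=> powR_ge0 _ _)) H.
have -> : 8 = 4 * 2 :> R by ring.
rewrite -mulrA ler_pM ?powR_ge0//.
  by apply: sumr_ge0 => j _; rewrite mulr_ge0 ?powR_ge0.
apply: H; last exact: psum_ge0.
by move=> j; rewrite doub ler_wpM2r ?powR_ge0.
Qed.

End TreeType.

(** * Haar polynomials as trees *)

Section HaarIntegral.
Variable R : realType.
Local Open Scope classical_set_scope.
Implicit Types (t : R) (k j i n : nat).

Lemma dyadicE k j t :
  dyadic k j.+1 t = (j%:R <= t * 2 ^+ k < j.+1%:R)%R :> Prop.
Proof.
by rewrite /dyadic /= in_itv /= ler_pdivrMr ?ltr_pdivlMr// exprn_gt0.
Qed.

Lemma dyadic_inj k i j t : dyadic k i.+1 t -> dyadic k j.+1 t -> i = j.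
Proof.
rewrite !dyadicE => /andP[i1 i2] /andP[j1 j2]; apply/eqP.
have lt_S a b : (a%:R < b.+1%:R :> R)%R -> (a <= b)%N by rewrite ltr_nat.
by rewrite eqn_leq !lt_S// ?(le_lt_trans i1 j2) ?(le_lt_trans j1 i2).
Qed.

Lemma dyadic_split k j :
  @dyadic R k j.+1 = dyadic k.+1 (2 * j).+1 `|` dyadic k.+1 (2 * j).+2.
Proof.
have E2 m : (2 * m)%:R = m%:R * 2 :> R by rewrite natrM mulrC.
apply/seteqP; split => [t|t []]; rewrite !dyadicE ?[_ ^+ k.+1]exprSr ?mulrA.
- move=> /andP[jt tj]; have [h|h] := ltP (t * 2 ^+ k * 2) (2 * j).+1%:R.
    by left; rewrite dyadicE exprSr mulrA h andbT E2 ler_pM2r.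
  right; rewrite dyadicE exprSr mulrA h /=.
  by rewrite -[(2 * j).+2]/(2 + 2 * j)%N -mulnS E2 ltr_pM2r.
- move=> /andP[]; rewrite E2 ler_pM2r// => -> /= h.
  rewrite -(@ltr_pM2r _ 2)// -E2 (lt_le_trans h)// ler_nat mulnS addSn ltnS.
  by rewrite add1n leqnSn.
- move=> /andP[h]; rewrite -[(2 * j).+2]/(2 + 2 * j)%N -mulnS E2 ltr_pM2r// => ->.
  rewrite andbT -(@ler_pM2r _ 2)// -E2 (le_trans _ h)// ler_nat leqnSn//.
Qed.

Lemma dyadic_disjoint k i j : i != j ->
  [disjoint @dyadic R k i.+1 & @dyadic R k j.+1].
Proof.
move=> ij; apply/eqP; apply/seteqP; split => // t [ti tj].
by rewrite (dyadic_inj ti tj) eqxx in ij.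
Qed.

Lemma measurable_dyadic k j : measurable (@dyadic R k j).
Proof. exact: measurable_itv. Qed.

Variable V : normedModType R.
Implicit Types (x : nat -> nat -> V).

Lemma haar_neq0 k i j t : dyadic k.+1 j.+1 t -> haar k.+1 i.+1 t != 0 -> i = j./2.
Proof.
move=> tj; rewrite /haar; have -> : (2 * i.+1).-1 = (2 * i).+1 by rewrite mulnS.
have -> : (2 * i.+1)%N = (2 * i).+2 by rewrite mulnS.
case: ifPn => [|_]; [|case: ifPn => [|_]]; last by rewrite eqxx.
- by rewrite inE => /(dyadic_inj tj) ->; rewrite mul2n doubleK.
- by rewrite inE => /(dyadic_inj tj) ->; rewrite mul2n /= uphalf_double.
Qed.

(** The interval is one half of the support of the Haar function numbered [j./2] from zero; the
    parity of [j] tells which half, hence the sign. *)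
Lemma haar_levelE x k j t : (j < 2 ^ k.+1)%N -> dyadic k.+1 j.+1 t ->
  haar_level x k.+1 t =
  (if odd j then -1 else 1) *: (powR 2 (k%:R / 2) *: x k.+1 (j./2).+1).
Proof.
move=> jk tj; rewrite /haar_level /= big_add1 big_mkord.
have j2k : (j./2 < 2 ^ k)%N by rewrite ltn_half_double -mul2n -expnS.
rewrite (bigD1 (Ordinal j2k))//= big1 ?addr0 => [|i ij]; last first.
  have [->|/(haar_neq0 tj) ij2] := eqVneq (haar k.+1 i.+1 t) 0.
    by rewrite scale0r.
  by rewrite -val_eqE /= ij2 eqxx in ij.
rewrite scalerA /haar -[k.+1.-1]/k.
have -> : (2 * (j./2).+1).-1 = (j./2).*2.+1 by rewrite mul2n doubleS.
have -> : (2 * (j./2).+1)%N = (j./2).*2.+2 by rewrite mul2n doubleS.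
have := odd_double_half j; case: (odd j) => jE.
  rewrite memNset ?mem_set ?mulN1r//; first by rewrite -jE in tj.
  move=> /(dyadic_inj tj) /eqP; rewrite -{1}jE add1n.
  by rewrite (gtn_eqF (ltnSn _)).
by move: jE; rewrite add0n => jE; rewrite mem_set ?mul1r// jE.
Qed.

(** The node at generation [k] and zero-based position [j] stands for a dyadic interval, and its
    children for the two halves; the Haar normalization is part of the increment. *)
Fixpoint haar_tree x n k j : tree V :=
  if n is n'.+1 then
    Node (powR 2 (k%:R / 2) *: x k.+1 j.+1)
      (haar_tree x n' k.+1 (2 * j)) (haar_tree x n' k.+1 (2 * j).+1)
  else Leaf.

Lemma full_haar_tree x n k j : full n (haar_tree x n k j).
Proof. by elim: n k j => //= n IHn k j; rewrite !IHn. Qed.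

(** On each half, level [k.+1] is constant and becomes a fixed head of the argument of [F], so the
    induction needs [F] arbitrary. Measurability is carried along because splitting the integral
    uses it. *)
Lemma integral_dyadic x n k j (F : seq V -> R) :
  (forall w, 0 <= F w) -> (j < 2 ^ k)%N ->
  measurable_fun (dyadic k j.+1) (fun t => F [seq haar_level x i t | i <- iota k.+1 n])
  /\ (\int[lebesgue_measure]_(t in dyadic k j.+1)
       (F [seq haar_level x i t | i <- iota k.+1 n])%:E
     = ((2 ^+ k)^-1 * mean (haar_tree x n k j) F)%R%:E)%E.
Proof.
elim: n k j F => [|n IHn] k j F F0 jk /=.
  split; first exact: measurable_cst.
  have mdy : measurable (@dyadic R k j.+1) by exact: measurable_dyadic.
  apply: etrans (integral_cst lebesgue_measure mdy (F [::])%:E) _.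
  rewrite /= lebesgue_measure_itv /= lte_fin.
  rewrite ltr_pM2r ?invr_gt0 ?exprn_gt0// ltr_nat ltnSn -EFinB -EFinM.
  by congr (_%:E); rewrite -natr1; field; rewrite expf_neq0.
have jl : (2 * j < 2 ^ k.+1)%N by rewrite expnS ltn_pmul2l.
have jr : ((2 * j).+1 < 2 ^ k.+1)%N.
  by rewrite expnS -[(_.+1 < _)%N]/(2 + 2 * j <= _)%N -mulnS leq_pmul2l.
set a := powR 2 _ *: _.
have [ml il] := IHn k.+1 (2 * j)%N (fun w => F (a :: w)) (fun=> F0 _) jl.
have [mr ir] := IHn k.+1 (2 * j).+1 (fun w => F (- a :: w)) (fun=> F0 _) jr.
pose G t := F (haar_level x k.+1 t :: [seq haar_level x i t | i <- iota k.+2 n]).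
have Gl t : t \in dyadic k.+1 (2 * j).+1 ->
    F (a :: [seq haar_level x i t | i <- iota k.+2 n]) = G t.
  rewrite inE => tj; rewrite /G (haar_levelE _ jl tj) oddM /= scale1r.
  by rewrite mul2n doubleK.
have Gr t : t \in dyadic k.+1 (2 * j).+2 ->
    F (- a :: [seq haar_level x i t | i <- iota k.+2 n]) = G t.
  rewrite inE => tj; rewrite /G (haar_levelE _ jr tj) /= oddM /= scaleN1r.
  by rewrite mul2n uphalf_double.
have {}ml := eq_measurable_fun _ Gl ml.
have {}mr := eq_measurable_fun _ Gr mr.
have mG : measurable_fun (dyadic k.+1 (2 * j).+1 `|` dyadic k.+1 (2 * j).+2) G.
  by apply/measurable_funU; [exact: measurable_dyadic|exact: measurable_dyadic|split].
rewrite dyadic_split; split => //.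
rewrite (@ge0_integral_setU _ _ _ lebesgue_measure); last 5 first.
- exact: measurable_dyadic.
- exact: measurable_dyadic.
- exact/measurable_realfun.measurable_EFinP.
- by move=> t _; rewrite lee_fin.
- by apply: dyadic_disjoint; rewrite neq_ltn ltnSn.
have -> : (\int[lebesgue_measure]_(t in dyadic k.+1 (2 * j).+1) (G t)%:E =
    \int[lebesgue_measure]_(t in dyadic k.+1 (2 * j).+1)
      (F (a :: [seq haar_level x i t | i <- iota k.+2 n]))%:E)%E.
  by apply: eq_integral => t tl; rewrite Gl.
have -> : (\int[lebesgue_measure]_(t in dyadic k.+1 (2 * j).+2) (G t)%:E =
    \int[lebesgue_measure]_(t in dyadic k.+1 (2 * j).+2)
      (F (- a :: [seq haar_level x i t | i <- iota k.+2 n]))%:E)%E.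
  by apply: eq_integral => t tl; rewrite Gr.
rewrite il ir -EFinD; congr (_%:E).
by rewrite exprS; field; rewrite expf_neq0.
Qed.

End HaarIntegral.

(** * Norms and coefficients of Haar polynomials read on trees *)

Section HaarTrees.
Variables (R : realType) (V : normedModType R).
Implicit Types (x : nat -> nat -> V).

Lemma integral_haar_levels x n (F : seq V -> R) (f : R -> R) :
  (forall w, 0 <= F w) ->
  (forall t, f t = F [seq haar_level x i t | i <- iota 1 n]) ->
  (\int[lebesgue_measure]_(t in `[0%R, 1%R[) (f t)%:E
   = (mean (haar_tree x n 0 0) F)%:E)%E.
Proof.
move=> F0 /funext ->; have [_] := integral_dyadic x n F0 (ltn0Sn 0 : 0 < 2 ^ 0)%N.
by rewrite /dyadic expr0 !divr1 invr1 mul1r.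
Qed.

Lemma haar_sumE x n t :
  haar_sum n x t = \sum_(v <- [seq haar_level x i t | i <- iota 1 n]) v.
Proof. by rewrite big_map /haar_sum /index_iota subn1. Qed.

Lemma Lqnorm_haar_level x n k q : q != 0 -> (0 < k <= n)%N ->
  poweR (Lqnorm q (haar_level x k)) q =
  (mean (haar_tree x n 0 0) (fun w => powR `|nth 0 w k.-1| q))%:E.
Proof.
move=> q0 /andP[k0 kn]; rewrite /Lqnorm.
have m0 : 0 <= mean (haar_tree x n 0 0) (fun w => powR `|nth 0 w k.-1| q).
  by apply: mean_ge0 => w; exact: powR_ge0.
rewrite (integral_haar_levels (x := x) (n := n) (F := fun w => powR `|nth 0 w k.-1| q)).
- by rewrite !poweR_EFin -powRrM mulVf// powRr1.
- by move=> w; exact: powR_ge0.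
move=> t; rewrite (nth_map 0%N) ?size_iota ?prednK// nth_iota ?prednK//.
by rewrite add1n prednK.
Qed.

(** The inner norms and the outer sum have the same exponent, so everything collapses into the mean
    of a [p]-sum. *)
Lemma sum_Lqnorm_haar_level x n q : q != 0 ->
  (\sum_(1 <= k < n.+1) poweR (Lqnorm q (haar_level x k)) q =
   (mean (haar_tree x n 0 0) (psum q))%:E)%E.
Proof.
move=> q0.
rewrite (eq_big_nat _ _ (F2 := fun k =>
  (mean (haar_tree x n 0 0) (fun w => powR `|nth 0 w k.-1| q))%:E)); last first.
  by move=> k kn; exact: Lqnorm_haar_level.
rewrite big_add1 sumEFin -mean_sum; congr (_%:E); apply: eq_mean.
apply: all_paths_imp (full_size (full_haar_tree x n 0 0)) => w wn.
by rewrite /psum [RHS](big_nth 0) wn.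
Qed.

Lemma big_double (F : nat -> R) n :
  \sum_(i < n.*2) F i = \sum_(i < n) (F i.*2 + F i.*2.+1).
Proof.
elim: n => [|n IHn]; first by rewrite !big_ord0.
by rewrite doubleS !big_ord_recr IHn /= addrA.
Qed.

Lemma sqr_powR2_half k : powR 2 (k%:R / 2) ^+ 2 = 2 ^+ k :> R.
Proof.
by rewrite -powR_mulrn ?powR_ge0// -powRrM mulfVK ?powR_mulrn.
Qed.

(** An interval of generation [k] has measure [2^-k], which cancels the factor [2^k] in the squared
    increment. *)
Lemma mean_sumsq_haar_tree x n k :
  \sum_(j < 2 ^ k) (2 ^+ k)^-1 *
     mean (haar_tree x n k j) (fun w => \sum_(v <- w) `|v| ^+ 2) =
  \sum_(k <= i < k + n) \sum_(j < 2 ^ i) `|x i.+1 j.+1| ^+ 2.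
Proof.
elim: n k => [|n IHn] k.
  by rewrite addn0 big_geq// big1// => j _; rewrite /= big_nil mulr0.
rewrite big_ltn; last by rewrite addnS ltnS leq_addr.
rewrite -addSnnS -IHn expnS mul2n (big_double (fun j => (2 ^+ k.+1)^-1 *
  mean (haar_tree x n k.+1 j) (fun w => \sum_(v <- w) `|v| ^+ 2))).
rewrite -big_split; apply: eq_bigr => j _ /=.
have step (t : tree V) c : `|c| = powR 2 (k%:R / 2) * `|x k.+1 j.+1| ->
    mean t (fun w => \sum_(v <- c :: w) `|v| ^+ 2) =
    2 ^+ k * `|x k.+1 j.+1| ^+ 2 + mean t (fun w => \sum_(v <- w) `|v| ^+ 2).
  move=> cE; rewrite -[X in X + _](mean_cst _ t) -meanD; apply: eq_mean.
  apply: all_pathsT => w; rewrite big_cons cE exprMn sqr_powR2_half//.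
have a0 : `|powR 2 (k%:R / 2) *: x k.+1 j.+1| = powR 2 (k%:R / 2) * `|x k.+1 j.+1|.
  by rewrite normrZ ger0_norm ?powR_ge0.
rewrite !step ?normrN// mul2n [2 ^+ k.+1]exprS.
by field; rewrite expf_neq0.
Qed.

Lemma sumsq_haar_tree x n :
  \sum_(1 <= k < n.+1) \sum_(1 <= j < (2 ^ k.-1).+1) `|x k j| ^+ 2 =
  mean (haar_tree x n 0 0) (fun w => \sum_(v <- w) `|v| ^+ 2).
Proof.
have := mean_sumsq_haar_tree x n 0.
rewrite expn0 big_ord1 expr0 invr1 mul1r => -> /=.
rewrite big_add1 add0n; apply: eq_bigr => i _.
by rewrite big_add1 big_mkord.
Qed.

Definition root (t : tree V) : V := if t is Node x _ _ then x else 0.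

(** The [k] binary digits of [j], leading digit first, are the turns taken from the root; [Leaf] is
    the default past the end of the tree. *)
Fixpoint subtree (t : tree V) (k j : nat) : tree V :=
  if k is k'.+1 then
    if subtree t k' j./2 is Node _ l r then if odd j then r else l else Leaf
  else t.

Definition haar_coef (t : tree V) (k j : nat) : V :=
  (powR 2 (k.-1%:R / 2))^-1 *: root (subtree t k.-1 j.-1).

(** Every full tree comes from a Haar polynomial, so the type hypothesis applies to the trees
    produced by compression. *)
Lemma haar_tree_coef t n k j :
  full n (subtree t k j) -> haar_tree (haar_coef t) n k j = subtree t k j.
Proof.
elim: n k j => [|n IHn] k j /=; first by case: subtree.
case E : (subtree t k j) => [//|a l r] /andP[fl fr].
rewrite !IHn /= ?mul2n /= ?uphalf_double ?doubleK ?odd_double E //=.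
by rewrite /haar_coef /= E scalerA divff ?scale1r//.
Qed.

End HaarTrees.

(** * Haar type constants expressed on trees, and the logarithmic bound *)

Section HaarType.
Variables (R : realType) (X Y : normedModType R) (T : {linear X -> Y}).
Implicit Types (x : nat -> nat -> X).

Lemma Lqnorm_haar_sum x n q :
  Lqnorm q (haar_sum n (fun k j => T (x k j))) =
  (powR (mean (haar_tree x n 0 0) (fun w => powR `|T (\sum_(v <- w) v)| q)) q^-1)%:E.
Proof.
rewrite /Lqnorm.
rewrite (integral_haar_levels (x := x) (n := n)
  (F := fun w => powR `|T (\sum_(v <- w) v)| q))//.
move=> t; rewrite -haar_sumE /haar_sum linear_sum; congr (powR `|_| q).
apply: eq_bigr => k _; rewrite /haar_level linear_sum; apply: eq_bigr => j _.
by rewrite linearZ.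
Qed.

(** Strict inequality yields an admissible constant below [c] without knowing that the infimum is
    attained. *)
Lemma tau_tree c m (t : tree X) : 0 <= c -> (tau T m < c%:E)%E -> full m t ->
  mean t (fun w => `|T (\sum_(x <- w) x)| ^+ 2) <=
  c ^+ 2 * mean t (fun w => \sum_(x <- w) `|x| ^+ 2).
Proof.
move=> c0 /ereal_inf_lt[_ [c' [c'0 Hc'] <-]]; rewrite lte_fin => c'c ft.
have := Hc' (haar_coef t); rewrite Lqnorm_haar_sum sumsq_haar_tree.
rewrite (@haar_tree_coef _ _ t m 0 0 ft) /= lee_fin.
set S := mean t (fun w => \sum_(x <- w) _).
have S0 : 0 <= S by apply: mean_ge0 => w; apply: sumr_ge0 => v _; exact: sqr_ge0.
have -> : mean t (fun w => powR `|T (\sum_(v <- w) v)| 2) =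
    mean t (fun w => `|T (\sum_(x <- w) x)| ^+ 2).
  by apply: eq_mean; apply: all_pathsT => w; rewrite powR_mulrn.
set A := mean t _.
have A0 : 0 <= A by apply: mean_ge0 => w; exact: sqr_ge0.
rewrite !powR12_sqrt// => H.
rewrite -[A]sqr_sqrtr// -[S]sqr_sqrtr// -exprMn.
rewrite lerXn2r ?nnegrE ?mulr_ge0 ?sqrtr_ge0// (le_trans H)//.
by rewrite ler_wpM2r ?sqrtr_ge0// ltW.
Qed.

End HaarType.

(** The left side is the number [L.+1] of classes for [L = (trunc_log 2 n).+1], a choice ensuring
    [n <= 2 ^ L]. *)
Lemma trunc_log_ln (R : realType) n : (0 < n)%N ->
  ((trunc_log 2 n).+2%:R : R) <= (2 + (ln 2)^-1) * (1 + ln n%:R).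
Proof.
move=> n0; have l2 : 0 < ln 2 :> R by rewrite ln_gt0// ltr1n.
have ln0 : 0 <= ln n%:R :> R by rewrite ln_ge0// ler1n.
have : (trunc_log 2 n)%:R * ln 2 <= ln n%:R :> R.
  rewrite mulr_natl -lnXn// ler_ln ?posrE ?exprn_gt0 ?ltr0n//.
  by rewrite -natrX ler_nat trunc_logP.
rewrite -ler_pdivlMr// => H; rewrite -addn2 natrD.
have i2 : 0 < (ln 2 : R)^-1 by rewrite invr_gt0.
lra.
Qed.

Theorem theorem5p6 (R : realType) (X Y : completeNormedModType R)
  (T : {linear X -> Y})
  (Tbounded : exists M : R, forall x : X, `|T x| <= M * `|x|)
  (p : R) (hp1 : 1 <= p) (hp2 : p < 2) :
  weak_haar_type T p ->
  exists c : R, 0 <= c /\ forall n : nat, (0 < n)%N ->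
    (tau_q T p n <= (c * (1 + ln n%:R))%:E)%E.
Proof.
move=> [c0 [c0_ge0 Hc0]]; case: Tbounded => M0 HM0.
(* The absolute value makes the operator bound nonnegative; [c0 + 1] gives the strict inequality
   that [tau_tree] requires. *)
pose M := `|M0|; pose C := c0 + 1.
have TM x : `|T x| <= M * `|x|.
  by apply: le_trans (HM0 x) _; rewrite ler_wpM2r// ler_norm.
have C0 : 0 <= C by rewrite addr_ge0.
have p0 : 0 < p by rewrite (lt_le_trans ltr01).
have TC m (t : tree X) : (0 < m)%N -> full m t ->
    mean t (fun w => `|T (\sum_(x <- w) x)| ^+ 2) <=
    (C * powR m%:R (p^-1 - 2^-1)) ^+ 2 * mean t (fun w => \sum_(x <- w) `|x| ^+ 2).
  move=> m0; apply: tau_tree; first by rewrite mulr_ge0 ?powR_ge0.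
  apply: le_lt_trans (Hc0 m m0) _.
  by rewrite lte_fin ltr_pM2r ?powR_gt0 ?ltr0n// ltrDl.
set K := 8 * (1 + (1 - powR 2 (p - 2))^-1).
have K0 : 0 <= K.
  by rewrite mulr_ge0// addr_ge0// invr_ge0 subr_ge0 ltW// powR2_lt1// subr_lt0.
have M_ge0 : 0 <= M by exact: normr_ge0.
have B0 : 0 <= 2 * C + M + 1 by rewrite addr_ge0// addr_ge0// mulr_ge0.
have l2 : 0 <= 2 + (ln 2)^-1 :> R by rewrite addr_ge0// invr_ge0 ln_ge0// ler1n.
(* The first two factors come from [tree_type] after a [p]-th root; the last converts the number of
   classes into [1 + ln n]. *)
exists (powR K p^-1 * (2 * C + M + 1) * (2 + (ln 2)^-1)).
split; first by rewrite !mulr_ge0// powR_ge0.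
move=> n n0; apply: ereal_inf_lbound; eexists; last reflexivity.
have ln0 : 0 <= ln n%:R :> R by rewrite ln_ge0// ler1n.
split; first by rewrite !mulr_ge0// ?powR_ge0// addr_ge0.
move=> x; rewrite Lqnorm_haar_sum sum_Lqnorm_haar_level ?gt_eqF// lee_fin.
set t := haar_tree _ _ _ _.
have tn : all_paths (fun w => (size w <= n)%N) t.
  by apply: all_paths_imp (full_size (full_haar_tree x n 0 0)) => w ->.
have nL : (n <= 2 ^ (trunc_log 2 n).+1)%N by rewrite ltnW// trunc_log_ltn.
have := tree_type hp1 hp2 M_ge0 C0 TM TC nL tn; rewrite -/K.
set S := mean t (psum p); set D := _ * (2 * C + M + 1).
have S0 : 0 <= S by apply: mean_ge0 => w; exact: psum_ge0.
have D0 : 0 <= D by rewrite mulr_ge0.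
set A := mean t _.
have A0 : 0 <= A by apply: mean_ge0 => w; exact: powR_ge0.
move=> AS; apply: (@le_trans _ _ (powR (K * powR D p * S) p^-1)).
  have B : 0 <= K * powR D p * S by rewrite mulr_ge0// mulr_ge0// powR_ge0.
  by apply: ge0_ler_powR; rewrite ?invr_ge0 ?nnegrE ?(ltW p0).
have KD : 0 <= K * powR D p by rewrite mulr_ge0// powR_ge0.
rewrite (powRM _ KD S0) (powRM _ K0 (powR_ge0 _ _)) -powRrM divff ?gt_eqF// powRr1//.
rewrite ler_wpM2r ?powR_ge0// -!mulrA ler_wpM2l ?powR_ge0//.
rewrite /D mulrC ler_wpM2l//.
exact: trunc_log_ln.
Qed.
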